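(* Let $K$ be a field, let $S=K[x_1,\ldots,x_n]$ and let $I\subset S$ be a squarefree monomial ideal. Then: (a) for every integer $k\ge 1$, $I^{[k]}=0$ if and only if $k>\nu(I)$; (b) $g_I(k)\geq 0$ for all $k=1,\ldots,\nu(I)$.
   Context: Squarefree monomial ideals are understood to be proper ideals. For a monomial ideal $I$, $G(I)$ denotes its unique minimal set of monomial generators. For an integer $k\ge 1$, the $k$-th squarefree power $I^{[k]}$ of a squarefree monomial ideal $I$ is the ideal of $S$ generated by all products $u_1\cdots u_k$ with $u_1,\ldots,u_k\in G(I)$ that are squarefree monomials. $\nu(I)$ denotes the maximum length of a regular sequence of monomials contained in $I$. For $1\le k\le\nu(I)$ put $d_k=\min\{\deg u : u\in G(I^{[k]})\}$ and $g_I(k)=\operatorname{depth}(S/I^{[k]})-(d_k-1)$; the function $g_I$ is called the normalized depth function of $I$. *)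

(* Defs.v *)
From HB Require Import structures.
From mathcomp Require Import all_boot all_order all_algebra.
From mathcomp Require Import boolp classical_sets.
From mathcomp Require Import mpoly.

Set Implicit Arguments.
Unset Strict Implicit.
Unset Printing Implicit Defensive.

Import GRing.Theory.

Local Open Scope classical_set_scope.
Local Open Scope ring_scope.

Section Ideals.
Variable R : comNzRingType.

(* Unlike [idealr_closed], this does not require the ideal to be proper. *)
Definition is_ideal (J : set R) : Prop :=
  J 0 /\ forall a u v, J u -> J v -> J (a * u + v).

Definition ideal_gen (A : set R) : set R := smallest is_ideal A.

(* [regular_seq J s]: s is a regular sequence on the R-module R / J (J an
   ideal), with everything lifted to R: s`_i is a nonzerodivisor on
   R / (J, s`_0, ..., s`_(i-1)), and R / (J, s) is nonzero. *)
Definition regular_seq (J : set R) (s : seq R) : Prop :=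
  (forall i, (i < size s)%N -> forall f,
     ideal_gen (J `|` [set` take i s]) (s`_i * f) ->
     ideal_gen (J `|` [set` take i s]) f) /\
  ~ ideal_gen (J `|` [set` s]) 1.

End Ideals.

(* Extrema of sets of natural numbers: the supremum of a nonempty bounded set is
   its maximum, and the infimum of a nonempty set is its minimum. Both are 0
   when the extremum does not exist. *)
Definition nat_max (A : set nat) : nat := supremum 0%N A.
Definition nat_min (A : set nat) : nat := infimum 0%N A.

Section MonomialIdeals.
Variables (K : fieldType) (n : nat).
Implicit Types (I J : set {mpoly K[n]}) (A B : set 'X_{1..n}).

Definition graded_max_ideal : set {mpoly K[n]} :=
  ideal_gen [set 'X_i | i in [set: 'I_n]].

(* The depth of S / J with respect to the graded maximal ideal. *)
Definition depth J : nat :=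
  nat_max [set size s | s in
    [set s : seq {mpoly K[n]} |
      (forall f, f \in s -> graded_max_ideal f) /\ regular_seq J s]].

(* Monomials are represented by their exponent vectors. *)
Definition squarefree (m : 'X_{1..n}) : Prop := forall i, (m i <= 1)%N.

Definition monomial_ideal A : set {mpoly K[n]} :=
  ideal_gen [set 'X_[m] | m in A].

Definition squarefree_monomial_ideal I : Prop :=
  ~ I 1 /\ exists A, (forall m, A m -> squarefree m) /\ I = monomial_ideal A.

Definition minimal_monomial_generators I A : Prop :=
  monomial_ideal A = I /\
  forall B, B `<=` A -> monomial_ideal B = I -> B = A.

(* G(I): the unique A with [minimal_monomial_generators I A]. *)
Definition mingens I : set 'X_{1..n} :=
  xget set0 [set A | minimal_monomial_generators I A].

Definition squarefree_power I (k : nat) : set {mpoly K[n]} :=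
  monomial_ideal
    [set m | exists u : 'I_k -> 'X_{1..n},
       [/\ forall i, mingens I (u i),
           m = (\sum_(i < k) u i)%MM
         & squarefree m]].

(* The zero ideal as first argument of [regular_seq] gives regular sequences
   on S itself. *)
Definition nu I : nat :=
  nat_max [set size s | s in
    [set s : seq 'X_{1..n} |
      (forall m, m \in s -> I 'X_[m]) /\
      regular_seq [set 0] [seq 'X_[m] : {mpoly K[n]} | m <- s]]].

Definition min_degree I (k : nat) : nat :=
  nat_min [set mdeg u | u in mingens (squarefree_power I k)].

Definition normalized_depth I (k : nat) : int :=
  (depth (squarefree_power I k))%:Z - ((min_degree I k)%:Z - 1).

End MonomialIdeals.

(* Main.v *)
Require Import Defs.
From HB Require Import structures.
From mathcomp Require Import all_boot all_order all_algebra.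
From mathcomp Require Import boolp classical_sets.
From mathcomp Require Import mpoly.
From mathcomp Require Import ring zify.

(** For a squarefree monomial ideal I, a set of monomials is a regular
    sequence exactly when the monomials are nontrivial and have pairwise
    disjoint supports. Shrinking each of them to a minimal generator that
    divides it keeps the supports disjoint, so nu I is the largest number of
    minimal generators with squarefree product ([nu_geP]). This is part (a).

    Part (b) says that a nonzero ideal J generated by squarefree monomials of
    degree greater than d satisfies depth (S/J) >= d. The elementary
    symmetric polynomials e_1, ..., e_d are a regular sequence on S/J for
    every such J and over every field, finite ones included
    ([depth_squarefree_monomial_ideal]). The proof has two stages.

    First, let F be a set of variables and let S_F be the quotient of S by
    the variables outside F. In S_F the elements e_1, ..., e_|F| form a
    regular sequence, and each variable of F is a nonzerodivisor modulo e_1,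
    ..., e_i for i < |F| ([esyms_vars_regular]). Setting a variable to zero
    decreases |F|, which gives an induction, and in S_F the last one, e_|F|,
    is the product of the variables of F.

    Second, write x_F for the product of the variables in F, and let J be
    generated by the x_F with F in an up-closed family U. If F has minimal
    cardinality in U and J' is the ideal of U minus F, then J = J' + (x_F)
    while S_F is S/P for an ideal P with J' contained in P and x_F P
    contained in J'. Since x_F is regular on S_F modulo e_1, ..., e_i for i
    < |F|, regularity passes from S/J' to S/J ([nonzerodivisor_step]). The
    induction on the size of U starts from J = 0, which is the first stage
    with all variables.

    Since depth is a maximum, this bound also requires the lengths of all
    regular sequences on S/J, homogeneous or not, to be bounded. A regular
    sequence on S/J is algebraically independent over K
    ([regular_seq_independent]), whereas more than n polynomials in n
    variables are algebraically dependent by a count of dimensions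
    ([algebraically_dependent]). *)

Set Implicit Arguments.
Unset Strict Implicit.
Unset Printing Implicit Defensive.

Import GRing.Theory.

Local Open Scope classical_set_scope.
Local Open Scope ring_scope.

(** * Extrema of sets of natural numbers *)

Section Extrema.
Implicit Types (A : set nat).

Lemma nat_max_ge A b t : (forall a, A a -> (a <= b)%N) -> A t ->
  (t <= nat_max A)%N.
Proof.
move=> leAb At; apply: (ge_supremum_Nmem 0%N _ At).
by apply: nat_supremums_neq0; exists b => a /leAb.
Qed.

Lemma nat_max_mem A b t : (forall a, A a -> (a <= b)%N) -> A t ->
  A (nat_max A).
Proof.
move=> leAb At.
have exP : exists i, `[< A i >] by exists t; apply/asboolP.
have ubP i : `[< A i >] -> (i <= b)%N by move=> /asboolP /leAb.
case: (ex_maxnP exP ubP) => m /asboolP Am maxm.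
suff -> : nat_max A = m by [].
apply/eqP; rewrite eqn_leq (nat_max_ge leAb Am) andbT.
rewrite /nat_max /supremum; case: ifP => // _.
case: xgetP => [x _ [_ lbx]|_ //].
by apply: lbx => a Aa; apply: maxm; apply/asboolP.
Qed.

Lemma nat_min_le A t : A t -> (nat_min A <= t)%N.
Proof.
move=> At; apply: (le_infimum_Nmem 0%N _ At).
have exP : exists i, `[< A i >] by exists t; apply/asboolP.
case: (ex_minnP exP) => m /asboolP Am minm.
by exists m; split => [a Aa|a]; [apply: minm; apply/asboolP | apply].
Qed.

End Extrema.

(** * Ideals and nonzerodivisors *)

Section IdealTheory.
Variable R : comNzRingType.
Implicit Types (A B T J : set R) (f g u v x t : R) (s : seq R).

Lemma ideal_gen_ideal A : is_ideal (ideal_gen A).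
Proof.
split=> [M [[M0 _] _] // | a u v Au Av M MA].
by case: (MA) => [[_ Madd] _]; apply: Madd; [apply: Au | apply: Av].
Qed.

Lemma ideal_gen_sub A u : A u -> ideal_gen A u.
Proof. exact: (@sub_gen_smallest _ (@is_ideal R) A u). Qed.

Lemma ideal_gen_min A J : is_ideal J -> (forall u, A u -> J u) ->
  forall u, ideal_gen A u -> J u.
Proof. by move=> idJ AJ u; apply: smallest_sub. Qed.

Lemma ideal0 J : is_ideal J -> J 0.
Proof. by case. Qed.

Lemma idealD J u v : is_ideal J -> J u -> J v -> J (u + v).
Proof. by case=> _ Jadd Ju Jv; rewrite -[u]mul1r; apply: Jadd. Qed.

Lemma idealMl J a u : is_ideal J -> J u -> J (a * u).
Proof. by case=> J0 Jadd Ju; rewrite -[_ * _]addr0; apply: Jadd. Qed.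

Lemma idealN J u : is_ideal J -> J u -> J (- u).
Proof. by move=> idJ Ju; rewrite -mulN1r; apply: idealMl. Qed.

Lemma idealB J u v : is_ideal J -> J u -> J v -> J (u - v).
Proof. by move=> idJ Ju Jv; apply: idealD => //; apply: idealN. Qed.

Lemma ideal_sum J (I : Type) (r : seq I) (P : pred I) (F : I -> R) :
  is_ideal J -> (forall i, P i -> J (F i)) -> J (\sum_(i <- r | P i) F i).
Proof.
move=> idJ JF; elim/big_ind: _ => //; first exact: ideal0.
by move=> u v; apply: idealD.
Qed.

Lemma ideal_genS A B : (forall u, A u -> ideal_gen B u) ->
  forall u, ideal_gen A u -> ideal_gen B u.
Proof. by move=> AB; apply: ideal_gen_min => //; apply: ideal_gen_ideal. Qed.

Lemma ideal_gen_genU A T : ideal_gen (ideal_gen A `|` T) = ideal_gen (A `|` T).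
Proof.
apply/seteqP; split; apply: ideal_genS => u [Au|Tu].
- by apply: ideal_genS Au => v Av; apply: ideal_gen_sub; left.
- by apply: ideal_gen_sub; right.
- by apply: ideal_gen_sub; left; apply: ideal_gen_sub.
- by apply: ideal_gen_sub; right.
Qed.

Lemma ideal_colon J x : is_ideal J -> is_ideal [set f | J (x * f)].
Proof.
move=> idJ; split=> /= [|a u v Ju Jv]; first by rewrite mulr0; exact: ideal0.
have -> : x * (a * u + v) = a * (x * u) + x * v by ring.
by apply: (idealD idJ) => //; apply: (idealMl _ idJ).
Qed.

Lemma ideal_genU1P A x f :
  ideal_gen (A `|` [set x]) f <-> exists c, ideal_gen A (f - c * x).
Proof.
have idA := ideal_gen_ideal A; split; last first.
  move=> [c Ac]; rewrite -[f](subrK (c * x)).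
  have idAx := ideal_gen_ideal (A `|` [set x]).
  apply: (idealD idAx); last first.
    by apply: (idealMl _ idAx); apply: ideal_gen_sub; right.
  by move: Ac; apply: ideal_genS => u Au; apply: ideal_gen_sub; left.
move: f; apply: (@ideal_gen_min _ [set f | exists c, ideal_gen A (f - c * x)]).
  split=> [|a u v [c Ac] [d Ad]] /=.
    by exists 0; rewrite mul0r subrr; exact: ideal0.
  exists (a * c + d).
  have -> : a * u + v - (a * c + d) * x = a * (u - c * x) + (v - d * x) by ring.
  by apply: (idealD idA); first exact: (idealMl _ idA).
move=> u /= [Au|->].
  by exists 0; rewrite mul0r subr0; apply: ideal_gen_sub.
by exists 1; rewrite mul1r subrr; exact: ideal0.
Qed.

Definition nonzerodivisor J x := forall f, J (x * f) -> J f.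

Lemma nonzerodivisor1 J : nonzerodivisor J 1.
Proof. by move=> f; rewrite mul1r. Qed.

Lemma nonzerodivisorM J x t :
  nonzerodivisor J x -> nonzerodivisor J t -> nonzerodivisor J (x * t).
Proof. by move=> nx nt f; rewrite -mulrA => /nx/nt. Qed.

Lemma nonzerodivisor_congr J x t : is_ideal J -> J (x - t) ->
  nonzerodivisor J x -> nonzerodivisor J t.
Proof.
move=> idJ Jxt nx f Jtf; apply: nx.
have -> : x * f = f * (x - t) + t * f by ring.
by apply: (idealD idJ) => //; apply: (idealMl _ idJ).
Qed.

(** Half of the permutability of regular sequences, the half that needs no
    grading: if x, t is regular on R/(A), then x stays a nonzerodivisor
    modulo t.  A relation x f = c t modulo A makes c t vanish modulo x, so
    c = d x modulo A, and x can be cancelled from x (f - d t) = 0. *)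
Lemma nonzerodivisor_exchange A x t :
  nonzerodivisor (ideal_gen A) x ->
  nonzerodivisor (ideal_gen (A `|` [set x])) t ->
  nonzerodivisor (ideal_gen (A `|` [set t])) x.
Proof.
move=> nx nt f /ideal_genU1P[c Ac].
have idA := ideal_gen_ideal A.
have /nt /ideal_genU1P[d Ad] : ideal_gen (A `|` [set x]) (t * c).
  apply/ideal_genU1P; exists f.
  have -> : t * c - f * x = - (x * f - c * t) by ring.
  exact: (idealN idA).
apply/ideal_genU1P; exists d; apply: nx.
have -> : x * (f - d * t) = (x * f - c * t) + t * (c - d * x) by ring.
by apply: (idealD idA) => //; apply: (idealMl _ idA).
Qed.

(** Passage from R/(A, T) to R/(A, T, x), controlled by R/(B).  Since
    (B) kills x modulo (A), the kernel of R/(A) -> R/(A, x) is a quotient of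
    R/(B).  In a relation t f = g x modulo (A, T), the element g x vanishes modulo
    (B, T, t), where x can be cancelled; so g = c t modulo (B, T), hence
    g x = c t x modulo (A, T), and t can be cancelled from t (f - c x) = 0. *)
Lemma nonzerodivisor_step A B T x t :
  (forall u, A u -> ideal_gen B u) ->
  (forall u, B u -> ideal_gen A (x * u)) ->
  nonzerodivisor (ideal_gen (B `|` T `|` [set t])) x ->
  nonzerodivisor (ideal_gen (A `|` T)) t ->
  nonzerodivisor (ideal_gen (A `|` T `|` [set x])) t.
Proof.
move=> AB xBA nx nt f /ideal_genU1P[g ATg].
have idAT := ideal_gen_ideal (A `|` T).
have BTt u : ideal_gen (A `|` T) u -> ideal_gen (B `|` T) u.
  move=> ATu; rewrite -ideal_gen_genU; apply: ideal_genS ATu => v.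
  by case=> [/AB Bv|Tv]; apply: ideal_gen_sub; [left|right].
have /nx /ideal_genU1P[c BTc] : ideal_gen (B `|` T `|` [set t]) (x * g).
  apply/ideal_genU1P; exists f.
  have -> : x * g - f * t = - (t * f - g * x) by ring.
  by apply: (idealN (ideal_gen_ideal _)); apply: BTt.
have ATx : ideal_gen (A `|` T) (x * (g - c * t)).
  move: BTc; apply: (ideal_gen_min (ideal_colon x idAT)) => u [Bu|Tu] /=.
    have := xBA _ Bu; apply: ideal_genS => v Av.
    by apply: ideal_gen_sub; left.
  by apply: (idealMl _ idAT); apply: ideal_gen_sub; right.
apply/ideal_genU1P; exists c; apply: nt.
have -> : t * (f - c * x) = (t * f - g * x) + x * (g - c * t) by ring.
exact: (idealD idAT).
Qed.

End IdealTheory.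

(** * Monomial ideals and their minimal generators *)

Section MonomialTheory.
Variables (K : fieldType) (n : nat).
Implicit Types (I J : set {mpoly K[n]}) (A B : set 'X_{1..n}).
Implicit Types (m a : 'X_{1..n}) (f : {mpoly K[n]}).
Local Notation mideal := (@monomial_ideal K n).

Lemma monomial_idealP A f :
  mideal A f <->
  forall m, m \in msupp f -> exists2 a, A a & (a <= m)%MM.
Proof.
split; last first.
  move=> suppA; rewrite [f]mpolyE big_seq.
  apply: (ideal_sum _ (ideal_gen_ideal _)) => m /suppA[a Aa le_am].
  rewrite -(submK le_am) mpolyXD scalerAl.
  by apply: (idealMl _ (ideal_gen_ideal _)); apply: ideal_gen_sub; exists a.
move: f; apply: ideal_gen_min => [|u [a Aa <-] m]; last first.
  by rewrite msuppX mem_seq1 => /eqP->; exists a; rewrite ?lepm_refl.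
split=> [m|c u v Pu Pv m /msuppD_le]; first by rewrite msupp0.
rewrite mem_cat => /orP[|/Pv//].
case/msuppM_le/allpairsP => -[m1 m2] /= [_ /Pu[a Aa le_am] ->].
by exists a => //; apply: lepm_trans le_am (lem_addl _ _).
Qed.

Lemma monomial_idealX A m :
  mideal A 'X_[m] <-> exists2 a, A a & (a <= m)%MM.
Proof.
split; first by move/monomial_idealP; apply; rewrite msuppX mem_seq1.
by move=> Am; apply/monomial_idealP => m'; rewrite msuppX mem_seq1 => /eqP->.
Qed.

Lemma monomial_ideal_eq0 A :
  mideal A = [set 0] <-> forall m, ~ A m.
Proof.
split=> [A0 m Am|A0].
  have : mideal A 'X_[m].
    by apply/monomial_idealX; exists m; rewrite ?lepm_refl.
  rewrite A0 => /(congr1 (mcoeff m))/eqP.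
  by rewrite mcoeffX mcoeff0 eqxx oner_eq0.
apply/seteqP; split=> [f /monomial_idealP suppf|_ ->]; last first.
  exact: (ideal_gen_ideal _).1.
apply: msuppnil0; case: (msupp f) suppf => // m s /(_ m).
by rewrite mem_head => /(_ isT)[a /A0].
Qed.

Lemma monomial_ideal_sub A B : (forall a, A a -> exists2 b, B b & (b <= a)%MM) ->
  forall f, mideal A f -> mideal B f.
Proof.
move=> AB; apply: ideal_genS => _ [a /AB leB <-]; exact/monomial_idealX.
Qed.

Lemma lem_mdeg_eq m m' : (m' <= m)%MM -> (mdeg m <= mdeg m')%N -> m' = m.
Proof.
move=> le_m; rewrite -{1}(submK le_m) mdegD -{2}[mdeg m']add0n leq_add2r leqn0.
by rewrite mdeg_eq0 => /eqP d0; rewrite -(submK le_m) d0 add0m.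
Qed.

Lemma monomial_ideal_minimal A m : mideal A 'X_[m] ->
  exists2 a, (a <= m)%MM & mideal A 'X_[a] /\
    forall b, mideal A 'X_[b] -> (b <= a)%MM -> b = a.
Proof.
have [d] := ubnP (mdeg m); elim: d m => // d IHd m lt_md Am.
case: (pselect (forall b, mideal A 'X_[b] -> (b <= m)%MM -> b = m)).
  by move=> min_m; exists m; rewrite ?lepm_refl.
move=> /existsNP[b /not_implyP[Ab /not_implyP[le_bm ne_bm]]].
have lt_bm : (mdeg b < mdeg m)%N.
  by rewrite ltnNge; apply/negP => /(lem_mdeg_eq le_bm).
have [a le_ab Pa] := IHd b (leq_trans lt_bm lt_md) Ab.
by exists a => //; apply: lepm_trans le_ab le_bm.
Qed.

(** The minimal generators are the monomials of the ideal that are minimal for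
    divisibility. *)
Lemma mingensP A :
  minimal_monomial_generators (mideal A) (mingens (mideal A)).
Proof.
apply: xgetPex.
exists [set a | mideal A 'X_[a] /\
  forall b, mideal A 'X_[b] -> (b <= a)%MM -> b = a].
split.
  apply/seteqP; split; first by apply: ideal_genS => _ [a [Aa _] <-].
  apply: monomial_ideal_sub => a Aa.
  have [|b le_ba Pb] := @monomial_ideal_minimal A a; last by exists b.
  by apply/monomial_idealX; exists a; rewrite ?lepm_refl.
move=> B sBG genB; apply/seteqP; split=> // a [Aa min_a].
have : mideal B 'X_[a] by rewrite genB.
move=> /monomial_idealX[b Bb le_ba].
by rewrite -(min_a b) //; case: (sBG _ Bb).
Qed.

Lemma mingens_dvd A m : mideal A 'X_[m] ->
  exists2 u, mingens (mideal A) u & (u <= m)%MM.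
Proof. by move=> Am; apply/(monomial_idealX (mingens _)); rewrite (mingensP A).1. Qed.

(** Any generating family A contains the minimal generators: b is divisible by
    some a in A, and a by some minimal generator c; if c were not b, then b
    could be dropped from the minimal generators. *)
Lemma mingens_sub_gens A : mingens (mideal A) `<=` A.
Proof.
set G := mingens _ => b Gb; have [genG minG] := mingensP A.
have GA c : G c -> exists2 a, A a & (a <= c)%MM.
  move=> Gc; apply/monomial_idealX; rewrite -genG; apply/monomial_idealX.
  by exists c; rewrite ?lepm_refl.
have [a Aa le_ab] := GA b Gb.
have [|c Gc le_ca] := @mingens_dvd A a.
  by apply/monomial_idealX; exists a; rewrite ?lepm_refl.
have eq_cb : c = b.
  apply: contrapT => ne_cb.
  have sDG : G `\` [set b] `<=` G by move=> x [].
  suff /(minG _ sDG) eqG : mideal (G `\` [set b]) = mideal A.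
    have : (G `\` [set b]) b by rewrite eqG.
    by case=> _; apply.
  rewrite -genG; apply/seteqP; split; apply: monomial_ideal_sub => x.
    by case=> Gx _; exists x; rewrite ?lepm_refl.
  move=> Gx; case: (pselect (x = b)) => [->|ne_xb]; last by exists x; rewrite ?lepm_refl.
  by exists c; [split | apply: lepm_trans le_ca le_ab].
suff <- : a = b by [].
apply/mnmP => i; apply/eqP; rewrite eqn_leq.
by rewrite (mnm_lepP le_ab) -eq_cb (mnm_lepP le_ca).
Qed.

End MonomialTheory.

(** * Regular sequences of monomials and squarefree powers *)

Section MatchingNumber.
Variables (K : fieldType) (n : nat).
Implicit Types (I : set {mpoly K[n]}) (A : set 'X_{1..n}).
Implicit Types (m : 'X_{1..n}) (f : {mpoly K[n]}) (s : seq 'X_{1..n}).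
Local Notation mideal := (@monomial_ideal K n).
Local Notation mX := (fun m : 'X_{1..n} => 'X_[m] : {mpoly K[n]}).

Definition coprime_monomials m1 m2 := forall i, m1 i = 0%N \/ m2 i = 0%N.

Lemma coprime_monomials_lem m1 m2 m :
  coprime_monomials m1 m2 -> (m1 <= m2 + m)%MM -> (m1 <= m)%MM.
Proof.
move=> cop /mnm_lepP le12; apply/mnm_lepP => i; have := le12 i.
by rewrite mnmDE; case: (cop i) => ->.
Qed.

Lemma ideal_gen_monomials s :
  ideal_gen ([set 0] `|` [set` [seq mX m | m <- s]]) = mideal [set` s].
Proof.
apply/seteqP; split; apply: ideal_genS => u.
  case=> [->|/= /mapP[m sm ->]]; first exact: ideal0 (ideal_gen_ideal _).
  by apply: ideal_gen_sub; exists m.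
by case=> m sm <-; apply: ideal_gen_sub; right; apply: map_f.
Qed.

(** If x_i divides both s_a and s_b with a < b, then s_b kills s_a / x_i modulo
    the earlier terms, so some earlier s_c divides s_a / x_i.  Here c is not a,
    hence s_c and s_a are coprime by induction and s_c = 1, which contradicts
    properness. *)
Lemma regular_monomials_coprime s :
  regular_seq [set 0] [seq mX m | m <- s] ->
  forall b a, (a < b)%N -> (b < size s)%N ->
  coprime_monomials (nth 0%MM s b) (nth 0%MM s a).
Proof.
rewrite /regular_seq size_map ideal_gen_monomials => -[reg proper].
have nz c : (c < size s)%N -> nth 0%MM s c != 0%MM.
  move=> lt_c; apply/eqP => s0; apply: proper; rewrite -mpolyX0 -s0.
  by apply: ideal_gen_sub; exists (nth 0%MM s c) => //=; apply: mem_nth.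
move=> b; have [d] := ubnP b; elim: d b => // d IHd b lt_bd a lt_ab lt_bs i.
have lt_as := ltn_trans lt_ab lt_bs.
have [->|nz_b] := eqVneq (nth 0%MM s b i) 0%N; first by left.
have [->|nz_a] := eqVneq (nth 0%MM s a i) 0%N; first by right.
exfalso.
have : mideal [set` take b s] 'X_[nth 0%MM s a - U_(i)].
  have := reg b lt_bs 'X_[nth 0%MM s a - U_(i)].
  rewrite -map_take ideal_gen_monomials (nth_map 0%MM) // -mpolyXD; apply.
  apply/monomial_idealX; exists (nth 0%MM s a).
    by rewrite /= -(nth_take _ lt_ab) mem_nth // size_takel // ltnW.
  apply/mnm_lepP => j; rewrite mnmDE mnmBE mnm1E.
  by have [<-|_] := eqVneq i j; lia.
case/monomial_idealX=> m /= /(nthP 0%MM)[c].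
rewrite (size_takel (ltnW lt_bs)) => lt_cb; rewrite nth_take // => <- le_c.
have lt_cs := ltn_trans lt_cb lt_bs.
have [eq_ca|ne_ca] := eqVneq c a.
  have := mnm_lepP le_c i; rewrite eq_ca mnmBE mnm1E eqxx.
  by case: (nth 0%MM s a i) nz_a => // e _; rewrite subn1 ltnn.
have cop : coprime_monomials (nth 0%MM s c) (nth 0%MM s a).
  case: (ltngtP c a) ne_ca => // [lt_ca|lt_ac] _ j.
    by case: (IHd a (leq_trans lt_ab lt_bd) c lt_ca lt_as j); [right|left].
  exact: (IHd c (leq_trans lt_cb lt_bd) a lt_ac lt_cs j).
case/eqP: (nz c lt_cs); apply/mnmP => j; rewrite mnm0E.
case: (cop j) => // a0; have := mnm_lepP le_c j.
by rewrite mnmBE a0 sub0n leqn0 => /eqP.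
Qed.

Lemma coprime_monomials_regular s : 0%MM \notin s ->
  (forall b a, (a < b)%N -> (b < size s)%N ->
    coprime_monomials (nth 0%MM s b) (nth 0%MM s a)) ->
  regular_seq [set 0] [seq mX m | m <- s].
Proof.
move=> nz cop; rewrite /regular_seq size_map ideal_gen_monomials; split.
  move=> i lt_is f; rewrite -map_take ideal_gen_monomials (nth_map 0%MM) //.
  move=> /monomial_idealP suppf; apply/monomial_idealP => m fm.
  have [|a /= /(nthP 0%MM)[c]] := suppf (m + nth 0%MM s i)%MM.
    by rewrite mcoeff_msupp mulrC addmC mcoeffMX -mcoeff_msupp.
  rewrite (size_takel (ltnW lt_is)) => lt_ci; rewrite nth_take // => <- le_c.
  exists (nth 0%MM s c).
    by rewrite /= -(nth_take _ lt_ci) mem_nth // size_takel // ltnW.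
  apply: (@coprime_monomials_lem _ (nth 0%MM s i)); last by rewrite addmC.
  by move=> j; case: (cop i c lt_ci lt_is j); [right|left].
rewrite -mpolyX0 => /monomial_idealX[a /= sa le_a0].
case/negP: nz; suff <- : a = 0%MM by [].
by apply/mnmP => j; have := mnm_lepP le_a0 j; rewrite mnm0E leqn0 => /eqP.
Qed.

Lemma coprime_monomials_size s : 0%MM \notin s ->
  (forall b a, (a < b)%N -> (b < size s)%N ->
    coprime_monomials (nth 0%MM s b) (nth 0%MM s a)) ->
  (size s <= n)%N.
Proof.
move=> nz cop.
have [g gP] : {g : 'I_(size s) -> 'I_n &
    forall b : 'I_(size s), (nth 0%MM s b) (g b) != 0%N}.
  apply: (@choice _ _ (fun (b : 'I_(size s)) j => nth 0%MM s b j != 0%N)) => b.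
  apply: contrapT => all0; case/negP: nz.
  suff <- : nth 0%MM s b = 0%MM by apply: mem_nth.
  apply/mnmP => i; rewrite mnm0E; apply: contrapT => /eqP nzi.
  by apply: all0; exists i.
rewrite -[size s]card_ord -[n in (_ <= n)%N]card_ord.
apply: (@leq_card _ _ g) => b a eq_g; apply/val_inj.
have neg x y : g x = g y -> ~ (x < y)%N.
  move=> eq_xy lt_xy; have := gP x; have := gP y; rewrite eq_xy.
  by case: (cop y x lt_xy (ltn_ord y) (g y)) => ->.
by case: (ltngtP b a) => // /neg; [case | case/(_ (esym eq_g))].
Qed.

Lemma squarefree_sum (k : nat) (u : 'I_k -> 'X_{1..n}) :
  (forall i, squarefree (u i)) ->
  (forall i j, i != j -> coprime_monomials (u i) (u j)) ->
  squarefree (\sum_(i < k) u i)%MM.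
Proof.
move=> sq cop x; rewrite mnm_sumE.
case: (pickP (fun i => u i x != 0%N)) => [i nzi|all0].
  rewrite (bigD1 i) //= big1 ?addn0 => [|j ne_ji]; first exact: sq.
  by case: (cop j i ne_ji x) => // u0; rewrite u0 in nzi.
by rewrite big1 // => i _; apply/eqP/negPn; rewrite all0.
Qed.

Lemma squarefree_sum_coprime (k : nat) (u : 'I_k -> 'X_{1..n}) i j :
  squarefree (\sum_(i < k) u i)%MM -> i != j ->
  coprime_monomials (u i) (u j).
Proof.
move=> sq ne_ij x; have := sq x; rewrite mnm_sumE (bigD1 i) //=.
rewrite (bigD1 j) 1?eq_sym //=; lia.
Qed.

(** Coprimality is inherited by divisors, so the terms of a regular sequence of
    monomials may be replaced by minimal generators dividing them; squarefree
    generators are pairwise coprime exactly when their product is squarefree. *)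
Lemma nu_geP A k : ~ mideal A 1 -> (forall m, A m -> squarefree m) ->
  (k <= nu (mideal A))%N <->
  exists u : 'I_k -> 'X_{1..n},
    (forall i, mingens (mideal A) (u i)) /\ squarefree (\sum_(i < k) u i)%MM.
Proof.
move=> proper sqA.
have nz s : (forall m, m \in s -> mideal A 'X_[m]) -> 0%MM \notin s.
  by move=> sA; apply/negP => /sA; rewrite mpolyX0.
rewrite /nu; set L := (X in nat_max X).
have leLn a : L a -> (a <= n)%N.
  case=> s [/nz nzs reg] <-; apply: coprime_monomials_size nzs _.
  exact: regular_monomials_coprime reg.
split=> [le_k|[u [Gu sq]]].
  have L0 : L 0%N by exists [::] => //; split=> //; apply: coprime_monomials_regular.
  have [s [sA reg] szs] := nat_max_mem leLn L0.
  rewrite -szs in le_k.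
  have cops := regular_monomials_coprime reg.
  have [u uP] : {u : 'I_k -> 'X_{1..n} & forall i : 'I_k,
      mingens (mideal A) (u i) /\ (u i <= nth 0%MM s i)%MM}.
    apply: (@choice _ _ (fun (i : 'I_k) v =>
      mingens (mideal A) v /\ (v <= nth 0%MM s i)%MM)) => i.
    have [|v Gv le_v] := @mingens_dvd K n A (nth 0%MM s i); last by exists v.
    by apply: sA; apply: mem_nth; apply: leq_trans le_k.
  exists u; split=> [i|]; first by case: (uP i).
  apply: squarefree_sum => [i|i j ne_ij x].
    by apply: sqA; apply: (@mingens_sub_gens K); case: (uP i).
  have lex l : (u l x <= nth 0%MM s l x)%N by apply: mnm_lepP; case: (uP l).
  have lts (l : 'I_k) : (l < size s)%N by apply: leq_trans le_k.
  have := lex i; have := lex j.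
  case: (ltngtP i j) => [lt_ij|lt_ji|/val_inj eq_ij]; last by rewrite eq_ij eqxx in ne_ij.
    by case: (cops j i lt_ij (lts j) x) => ->; rewrite leqn0 => ? ?; [right|left]; apply/eqP.
  by case: (cops i j lt_ji (lts i) x) => ->; rewrite leqn0 => ? ?; [left|right]; apply/eqP.
apply: (nat_max_ge leLn); exists [seq u i | i <- enum 'I_k]; last first.
  by rewrite size_map size_enum_ord.
have Au m : m \in [seq u i | i <- enum 'I_k] -> mideal A 'X_[m].
  case/mapP => i _ ->; rewrite -(mingensP K A).1.
  by apply: ideal_gen_sub; exists (u i).
split=> //; apply: coprime_monomials_regular => [|b a lt_ab]; first exact: nz.
rewrite size_map size_enum_ord => lt_bk; have lt_ak := ltn_trans lt_ab lt_bk.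
have nthu c (lt_ck : (c < k)%N) :
    nth 0%MM [seq u i | i <- enum 'I_k] c = u (Ordinal lt_ck).
  rewrite (nth_map (Ordinal lt_ck)) ?size_enum_ord //; congr u.
  by apply: val_inj; rewrite /= nth_enum_ord.
rewrite !nthu; apply: (squarefree_sum_coprime sq).
by rewrite -val_eqE /= gtn_eqF.
Qed.

Lemma squarefree_power_eq0 I k : squarefree_monomial_ideal I ->
  squarefree_power I k = [set 0] <-> (nu I < k)%N.
Proof.
case=> proper [A [sqA defI]]; rewrite defI in proper *.
rewrite /squarefree_power monomial_ideal_eq0 ltnNge; split.
  move=> no_u; apply/negP => /(nu_geP _ proper sqA)[u [Gu sq]].
  by apply: (no_u (\sum_(i < k) u i)%MM); exists u.
move=> /negP lt_k m [u [Gu eq_m sq]]; apply/lt_k/nu_geP => //.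
by exists u; rewrite -eq_m.
Qed.

End MatchingNumber.

(** * The length of a regular sequence is at most the number of variables *)

Section AlgebraicIndependence.
Variables (K : fieldType) (n : nat).
Implicit Types (J : set {mpoly K[n]}) (f g : {mpoly K[n]}).

Lemma mpoly_split_var (r : nat) (P : {mpoly K[r]}) (i : 'I_r) :
  exists P0 Q : {mpoly K[r]}, [/\ P = P0 + 'X_i * Q,
    forall m, m \in msupp P0 -> m \in msupp P /\ m i = 0%N &
    forall m, m \in msupp Q -> (U_(i) + m)%MM \in msupp P].
Proof.
exists (\sum_(m <- msupp P | m i == 0%N) P@_m *: 'X_[m]).
exists (\sum_(m <- msupp P | m i != 0%N) P@_m *: 'X_[m - U_(i)]).
split=> [|m|m].
- rewrite {1}[P]mpolyE (bigID (fun m : 'X_{1..r} => m i == 0%N)) /=.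
  congr (_ + _); rewrite mulr_sumr; apply: eq_bigr => m nz.
  rewrite -scalerAr -mpolyXD addmC submK //; apply/mnm_lepP => j.
  by rewrite mnm1E; have [<-|_] := eqVneq i j; rewrite ?lt0n.
- move/msupp_sum_le/flattenP => [l /mapP[x]].
  rewrite mem_filter => /andP[/eqP x0 xP] -> /msuppZ_le.
  by rewrite msuppX mem_seq1 => /eqP ->.
- move/msupp_sum_le/flattenP => [l /mapP[x]].
  rewrite mem_filter => /andP[x0 xP] -> /msuppZ_le.
  rewrite msuppX mem_seq1 => /eqP ->; rewrite addmC submK //.
  apply/mnm_lepP => j.
  by rewrite mnm1E; have [<-|_] := eqVneq i j; rewrite ?lt0n.
Qed.

(** Write P = P_0 + y_0 Q with P_0 free of the first variable y_0.  A
    relation P (s) = 0 in S/J becomes P_0 (s) = 0 modulo s_0, a relation between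
    the remaining terms, so P_0 = 0 by induction on the number of variables.
    Then s_0 can be cancelled from s_0 Q (s) = 0, and Q has smaller degree. *)
Lemma regular_seq_independent J (r : nat) (s : r.-tuple {mpoly K[n]}) :
  is_ideal J -> regular_seq J s ->
  forall P : {mpoly K[r]}, J (P \mPo s) -> P = 0.
Proof.
move=> idJ [reg proper] P Js.
pose Ji i := ideal_gen (J `|` [set` take i s]).
have idJi i : is_ideal (Ji i) := ideal_gen_ideal _.
(* The variables before i have been eliminated from Q. *)
suff indep i : (i <= r)%N -> forall Q : {mpoly K[r]},
    (forall m, m \in msupp Q -> forall j : 'I_r, (j < i)%N -> m j = 0%N) ->
    Ji i (Q \mPo s) -> Q = 0.
  by apply: (indep 0%N) => //; apply: ideal_gen_sub; left.
move=> le_ir; have [e] := ubnP (r - i)%N; elim: e i le_ir => // e IHe i le_ir lt_e.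
case: (ltngtP i r) le_ir => // [lt_ir|eq_ir] _; last first.
  move=> Q Q0 JQ.
  have QC : Q = (Q@_0)%:MP.
    rewrite {1}[Q]mpolyE; apply/mpolyP => m; rewrite -mpolyE mcoeffC.
    have [<-|ne_m0] := eqVneq 0%MM m; first by rewrite mulr1.
    rewrite mulr0; apply: memN_msupp_eq0; apply: contra ne_m0 => /Q0 m0.
    by apply/eqP/mnmP => j; rewrite mnm0E m0 // eq_ir.
  rewrite QC; have [->|nzc] := eqVneq (Q@_0) 0; first by rewrite mpolyC0.
  exfalso; apply: proper; move: JQ.
  rewrite /Ji eq_ir take_oversize ?size_tuple // QC comp_mpolyC => JQ.
  have := idealMl ((Q@_0)^-1)%:MP (ideal_gen_ideal _) JQ.
  by rewrite -mpolyCM mulVf // mpolyC1.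
pose io := Ordinal lt_ir.
have nths : s`_i = tnth s io by rewrite (tnth_nth 0).
have sJ f : Ji i f -> Ji i.+1 f.
  apply: ideal_genS => x [Jx|sx]; apply: ideal_gen_sub; [by left|right].
  by rewrite /= (take_nth 0) ?size_tuple // mem_rcons inE; apply/orP; right.
move=> Q; have [d] : exists d, forall m, m \in msupp Q -> (mdeg m < d)%N.
  by exists (msize Q) => m; apply: msize_mdeg_lt.
elim: d Q => [|d IHd] Q degQ suppQ JQ.
  by apply: msuppnil0; case: (msupp Q) degQ => // m l /(_ m); rewrite mem_head => /(_ isT).
have [P0 [Q' [eqQ supp0 supp']]] := mpoly_split_var Q io.
have eqs : Q \mPo s = (P0 \mPo s) + s`_i * (Q' \mPo s).
  by rewrite {1}eqQ comp_mpolyD rmorphM /= comp_mpolyXU.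
have P00 : P0 = 0.
  apply: (IHe i.+1) => [//||m /supp0[/suppQ m0 mi] j|].
  - by lia.
  - rewrite ltnS leq_eqVlt => /orP[/eqP ji|]; last exact: m0.
    by rewrite (_ : j = io) //; apply: val_inj.
  have -> : P0 \mPo s = (Q \mPo s) - (Q' \mPo s) * s`_i by rewrite eqs; ring.
  apply: (idealB (idJi _)); first exact: sJ.
  apply: (idealMl _ (idJi _)); apply: ideal_gen_sub; right.
  by rewrite /= (take_nth 0) ?size_tuple // mem_rcons mem_head.
suff Q'0 : Q' = 0 by rewrite eqQ P00 Q'0 mulr0 addr0.
apply: IHd => [m /supp' /degQ|m /supp' /suppQ m0 j lt_ji|].
- by rewrite mdegD mdeg1 ltnS.
- by have := m0 j lt_ji; rewrite mnmDE => /eqP; rewrite addn_eq0 => /andP[_ /eqP].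
- apply: reg; first by rewrite size_tuple.
  by move: JQ; rewrite eqs P00 comp_mpoly0 add0r.
Qed.

Definition deg_le d f := forall m, m \in msupp f -> (mdeg m <= d)%N.

Lemma deg_leM d e f g : deg_le d f -> deg_le e g -> deg_le (d + e) (f * g).
Proof.
move=> df eg m /msuppM_le /allpairsP[[m1 m2] /= [/df d1 /eg d2 ->]].
by rewrite mdegD leq_add.
Qed.

Lemma deg_leX d f k : deg_le d f -> deg_le (d * k) (f ^+ k).
Proof.
move=> df; elim: k => [|k IHk]; last by rewrite exprS mulnS; apply: deg_leM.
by move=> m; rewrite expr0 msupp1 mem_seq1 => /eqP->; rewrite mdeg0.
Qed.

Lemma deg_le_prod (I : Type) (l : seq I) (d : I -> nat) (F : I -> {mpoly K[n]}) :
  (forall i, deg_le (d i) (F i)) ->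
  deg_le (\sum_(i <- l) d i) (\prod_(i <- l) F i).
Proof.
move=> dF; elim: l => [|i l IHl]; last by rewrite !big_cons; apply: deg_leM.
by move=> m; rewrite !big_nil msupp1 mem_seq1 => /eqP->; rewrite mdeg0.
Qed.

(** If every s_i has degree at most D, the N ^ r monomials in s with exponents
    below N lie in the span of the monomials in n variables with exponents
    below B = c * N, where c = D * r + 1.  There are c ^ n * N ^ n of the latter,
    which is less than N ^ r as soon as r > n and N > c ^ n. *)
Lemma algebraically_dependent (r : nat) (s : r.-tuple {mpoly K[n]}) :
  (n < r)%N -> exists2 P : {mpoly K[r]}, P != 0 & P \mPo s = 0.
Proof.
move=> lt_nr.
pose D := (\max_(i < r) msize (tnth s i))%N.
have degs i : deg_le D (tnth s i).
  move=> m /msize_mdeg_lt/ltnW le_m; apply: leq_trans le_m _.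
  exact: (@leq_bigmax _ (fun i => msize (tnth s i)) i).
pose c := (D * r).+1; pose N := (c ^ n).+1; pose B := (c * N)%N.
pose T := {ffun 'I_r -> 'I_N}; pose U := {ffun 'I_n -> 'I_B}.
pose mnT (t : T) : 'X_{1..r} := [multinom (t i : nat) | i < r].
pose mnU (u : U) : 'X_{1..n} := [multinom (u i : nat) | i < n].
have inj_mnT : injective mnT.
  move=> t1 t2 /mnmP eqt; apply/ffunP => i; apply: val_inj.
  by have := eqt i; rewrite !mnmE.
have degT t : deg_le (D * r * N) ('X_[mnT t] \mPo s).
  rewrite comp_mpolyX => m /(@deg_le_prod _ _ (fun i => D * mnT t i)%N) degm.
  apply: leq_trans (degm _) _ => [i|]; first exact: deg_leX.
  rewrite -big_distrr /= -mulnA leq_mul2l; apply/orP; right.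
  rewrite -[r in (_ <= r * _)%N]card_ord -sum_nat_const; apply: leq_sum => i _.
  by rewrite mnmE ltnW.
have cards : (#|{: U}| < #|{: T}|)%N.
  rewrite !card_ffun !card_ord /B expnMn.
  apply: (@leq_trans (N ^ n.+1)); last by rewrite leq_pexp2l.
  by rewrite expnS ltn_mul2r expn_gt0 /=.
pose M : 'M[K]_(#|{: T}|, #|{: U}|) := \matrix_(a, b)
  ('X_[mnT (enum_val a)] \mPo s)@_(mnU (enum_val b)).
have : kermx M != 0.
  rewrite kermx_eq0 /row_free; apply: contraL cards => /eqP <-.
  by rewrite -leqNgt rank_leq_col.
case/rowV0Pn => v /sub_kermxP vM nz_v.
pose P := \sum_a v 0 a *: 'X_[mnT (enum_val a)].
exists P.
  apply: contraNneq nz_v => P0; apply/eqP/rowP => a; rewrite mxE.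
  have := congr1 (mcoeff (mnT (enum_val a))) P0.
  rewrite mcoeff0 linear_sum /= (bigD1 a) //= mcoeffZ mcoeffX eqxx mulr1.
  rewrite big1 ?addr0 // => b ne_ba; rewrite mcoeffZ mcoeffX.
  by rewrite (inj_eq inj_mnT) (inj_eq enum_val_inj) (negPf ne_ba) mulr0.
have coefP m : (P \mPo s)@_m = \sum_a v 0 a * ('X_[mnT (enum_val a)] \mPo s)@_m.
  rewrite /P (raddf_sum (comp_mpoly s)) (raddf_sum (mcoeff m)).
  by apply: eq_bigr => a _; rewrite /= comp_mpolyZ mcoeffZ.
apply/mpolyP => m; rewrite coefP mcoeff0.
case: (pselect (forall i, (m i < B)%N)) => [ltB|/existsNP[i /negP]]; last first.
  rewrite -leqNgt => leB; apply: big1 => a _.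
  rewrite memN_msupp_eq0 ?mulr0 //; apply/negP => /degT.
  apply/negP; rewrite -ltnNge; apply: leq_trans (_ : (m i <= _)%N).
    by apply: leq_trans leB; rewrite /B ltn_mul2r /c ltnS leqnn.
  by rewrite mdegE (bigD1 i) //= leq_addr.
pose u : U := [ffun i => Ordinal (ltB i)].
have -> : m = mnU (enum_val (enum_rank u)).
  by apply/mnmP => i; rewrite enum_rankK mnmE ffunE.
have := congr1 (fun A : 'rV_ _ => A 0 (enum_rank u)) vM.
rewrite !mxE => vMu; rewrite -[RHS]vMu; apply: eq_bigr => a _.
by rewrite mxE.
Qed.

Lemma regular_seq_size J s : is_ideal J -> regular_seq J s -> (size s <= n)%N.
Proof.
move=> idJ reg; rewrite leqNgt; apply/negP => lt_ns.
have [P /eqP nzP P0] := algebraically_dependent (in_tuple s) lt_ns.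
apply: nzP; apply: (@regular_seq_independent J _ (in_tuple s) idJ reg).
by rewrite P0; apply: ideal0.
Qed.

Lemma depth_ge J s : is_ideal J -> (forall f, f \in s -> graded_max_ideal f) ->
  regular_seq J s -> (size s <= depth J)%N.
Proof.
move=> idJ max_s reg; apply: (@nat_max_ge _ n); last by exists s.
by move=> _ [t [_ regt] <-]; apply: regular_seq_size regt.
Qed.

End AlgebraicIndependence.

(** * Nonzerodivisors modulo homogeneous ideals *)

Section GradedIdeals.
Variables (K : fieldType) (n : nat).
Implicit Types (A : set {mpoly K[n]}) (f u v : {mpoly K[n]}).

Lemma pihomog_gen A f :
  (forall u, A u -> exists d, u \is d.-homog) -> ideal_gen A f ->
  forall d, ideal_gen A (pihomog mdeg d f).
Proof.
move=> homA Af d; have idA := ideal_gen_ideal A.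
suff pA : forall c, ideal_gen A (pihomog mdeg d (c * f)).
  by have := pA 1; rewrite mul1r.
move: f Af; apply: (@ideal_gen_min _ A
  [set f | forall c, ideal_gen A (pihomog mdeg d (c * f))]).
  split=> [c|a u v pu pv c] /=.
    by rewrite mulr0 pihomog0; apply: (ideal0 idA).
  by rewrite mulrDr mulrA pihomogD; apply: (idealD idA).
move=> u Au c; have [e homu] := homA u Au.
rewrite [c]mpolyE mulr_suml raddf_sum /=; apply: (ideal_sum _ idA) => m _.
rewrite -scalerAl linearZ /= -mul_mpolyC; apply: (idealMl _ idA).
have hom : 'X_[m] * u \is (mdeg m + e).-homog.
  by apply: dhomogM => //; rewrite dhomogX.
have [<-|ne] := eqVneq (mdeg m + e)%N d.
  by rewrite pihomog_dE //; apply: (idealMl _ idA); apply: ideal_gen_sub.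
by rewrite (pihomog_ne0 ne hom); apply: (ideal0 idA).
Qed.

Lemma pihomog_powX (a : 'I_n) k d v : (d < k)%N ->
  pihomog mdeg d ('X_a ^+ k * v) = 0.
Proof.
move=> lt_dk; rewrite [v]mpolyE mulr_sumr raddf_sum /= big1 // => m _.
rewrite -scalerAr linearZ /= mpolyXn -mpolyXD pihomogX /= mdegD mdegMn mdeg1 mul1n.
by rewrite gtn_eqF ?scaler0 // (leq_trans lt_dk) ?leq_addr.
Qed.

(** The half of permutability that needs the grading: if t f = 0 modulo A, then
    f = x_a v modulo A, with t v = 0 again, so f is divisible by every power of x_a modulo
    A.  A high power contributes nothing in a given degree, and each
    homogeneous component of f lies in the ideal of A. *)
Lemma nonzerodivisor_mod_var A (a : 'I_n) t :
  (forall u, A u -> exists d, u \is d.-homog) ->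
  nonzerodivisor (ideal_gen A) 'X_a ->
  nonzerodivisor (ideal_gen (A `|` [set 'X_a])) t ->
  nonzerodivisor (ideal_gen A) t.
Proof.
move=> homA nx nt f tf; have idA := ideal_gen_ideal A.
have divX k : exists v, ideal_gen A (t * v) /\ ideal_gen A (f - 'X_a ^+ k * v).
  elim: k => [|k [v [tv fv]]].
    by exists f; split=> //; rewrite expr0 mul1r subrr; apply: (ideal0 idA).
  have /nt /ideal_genU1P[w vw] : ideal_gen (A `|` [set 'X_a]) (t * v).
    by apply/ideal_genU1P; exists 0; rewrite mul0r subr0.
  exists w; split.
    apply: nx.
    have -> : 'X_a * (t * w) = t * v - t * (v - w * 'X_a) by ring.
    by apply: (idealB idA) => //; apply: (idealMl _ idA).
  have -> : f - 'X_a ^+ k.+1 * w =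
      (f - 'X_a ^+ k * v) + 'X_a ^+ k * (v - w * 'X_a) by rewrite exprS; ring.
  by apply: (idealD idA) => //; apply: (idealMl _ idA).
rewrite (pihomog_partitionE (leqnn (mmeasure mdeg f))).
apply: (ideal_sum _ idA) => d _; have [v [_ fv]] := divX d.+1.
have := pihomog_gen homA fv d.
by rewrite pihomogB pihomog_powX // subr0.
Qed.

End GradedIdeals.

(** * Elementary symmetric polynomials on squarefree monomial ideals *)

Section ElementarySymmetric.
Variables (K : fieldType) (n : nat).
Implicit Types (F G : {set 'I_n}) (A : set {mpoly K[n]}) (U : {set {set 'I_n}}).

Definition esyms (i : nat) : set {mpoly K[n]} :=
  [set` [seq mesym n K j | j <- iota 1 i]].

Definition vars F : set {mpoly K[n]} := [set 'X_b | b in [set` F]].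

Definition xprod F : {mpoly K[n]} := \prod_(i in F) 'X_i.

Definition xprods U : set {mpoly K[n]} := [set xprod F | F in [set` U]].

Lemma setU_esymsS A i :
  A `|` esyms i.+1 = A `|` esyms i `|` [set mesym n K i.+1].
Proof.
have iotaS : iota 1 i.+1 = iota 1 i ++ [:: i.+1] by rewrite -[i.+1]addn1 iotaD add1n addn1.
rewrite -setUA; congr (_ `|` _); rewrite /esyms iotaS map_cat.
apply/seteqP; split=> u; rewrite /= mem_cat mem_seq1.
  by case/orP => [iu|/eqP->]; [left|right].
by case=> [->//|->]; rewrite eqxx orbT.
Qed.

Lemma vars_setC_D1 A F a : a \in F ->
  vars (~: (F :\ a)) `|` A = vars (~: F) `|` A `|` [set 'X_a].
Proof.
move=> Fa; apply/seteqP; split=> u.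
  case=> [[b /= bF <-]|Au]; last by left; right.
  have [->|ne_ba] := eqVneq b a; first by right.
  by left; left; exists b => //=; move: bF; rewrite !inE ne_ba.
case=> [[[b /= bF <-]|Au]|->]; [|by right|].
  by left; exists b => //=; move: bF; rewrite !inE => /negPf ->; rewrite andbF.
by left; exists a => //=; rewrite !inE eqxx.
Qed.

Lemma homog_vars_esyms F i u : (vars F `|` esyms i) u -> exists d, u \is d.-homog.
Proof.
case=> [[b _ <-]|/mapP[j _ ->]]; last by exists j; apply: dhomog_mesym.
by exists 1%N; rewrite dhomogX; apply/eqP; apply: mdeg1.
Qed.

Lemma vars_xprod F G b : b \in G -> b \notin F ->
  ideal_gen (vars (~: F)) (xprod G).
Proof.
move=> Gb nFb; rewrite /xprod (bigD1 b) //= mulrC.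
apply: (idealMl _ (ideal_gen_ideal _)); apply: ideal_gen_sub.
by exists b => //=; rewrite inE.
Qed.

Lemma vars_nonzerodivisor F a : a \in F ->
  nonzerodivisor (ideal_gen (vars (~: F) `|` esyms 0)) 'X_a.
Proof.
move=> Fa f.
have -> : vars (~: F) `|` esyms 0 =
    [set 'X_[m] | m in [set U_(b)%MM | b in [set` ~: F]]].
  apply/seteqP; split=> u.
    by case=> [[b Fb <-]|//]; exists U_(b)%MM => //; exists b.
  by case=> m [b Fb <-] <-; left; exists b.
move=> /monomial_idealP suppf; apply/monomial_idealP => m fm.
have [|_ [b /= Fb <-] /mnm_lepP le_b] := suppf (U_(a) + m)%MM.
  by rewrite mcoeff_msupp mulrC mcoeffMX -mcoeff_msupp.
exists U_(b)%MM; first by exists b.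
apply/mnm_lepP => j; have := le_b j; rewrite mnmDE !mnm1E.
have [<-|//] := eqVneq b j; have [eq_ab|//] := eqVneq a b.
by move: Fb; rewrite inE -eq_ab Fa.
Qed.

(** Both statements are proved by induction on #|F|, because adding x_a to the
    ideal amounts to removing a from F.  Below the top degree, permuting x_a with
    e_(i+1) gives the claims for F from those for F minus a.  In the top degree
    e_|F| is the product of the variables of F, all of them nonzerodivisors. *)
Lemma esyms_vars_regular F i : (i < #|F|)%N ->
  nonzerodivisor (ideal_gen (vars (~: F) `|` esyms i)) (mesym n K i.+1) /\
  forall a, a \in F -> nonzerodivisor (ideal_gen (vars (~: F) `|` esyms i)) 'X_a.
Proof.
have [r] := ubnP #|F|; elim: r F i => // r IHr F i lt_Fr lt_iF.
have cardD1 a : a \in F -> (#|F :\ a|.+1 = #|F|)%N.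
  by move=> Fa; rewrite (cardsD1 a F) Fa.
have IHC a j : a \in F -> (j < #|F|.-1)%N -> nonzerodivisor
    (ideal_gen (vars (~: F) `|` esyms j `|` [set 'X_a])) (mesym n K j.+1).
  move=> Fa lt_jF; rewrite -vars_setC_D1 //.
  by have := cardD1 a Fa => cF; case: (IHr (F :\ a) j) => //; lia.
have D j a : (j < #|F|)%N -> a \in F ->
    nonzerodivisor (ideal_gen (vars (~: F) `|` esyms j)) 'X_a.
  move=> + Fa; elim: j => [_|j IHj lt_jF]; first exact: vars_nonzerodivisor.
  rewrite setU_esymsS; apply: nonzerodivisor_exchange; first by apply: IHj; apply: ltnW.
  by apply: IHC => //; lia.
split=> [|a]; last exact: D.
have /card_gt0P[a Fa] : (0 < #|F|)%N by apply: leq_ltn_trans lt_iF.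
case: (ltngtP i.+1 #|F|) lt_iF => // [lt_iF _|eq_iF _].
  apply: (@nonzerodivisor_mod_var _ _ _ a); first exact: homog_vars_esyms.
    by apply: D => //; apply: ltnW.
  by apply: IHC => //; lia.
apply: (@nonzerodivisor_congr _ _ (xprod F)).
- exact: ideal_gen_ideal.
- rewrite /mesym (bigD1 F) ?eq_iF //= opprD addrA subrr sub0r.
  apply: (idealN (ideal_gen_ideal _)); apply: (ideal_sum _ (ideal_gen_ideal _)).
  move=> G /andP[/eqP cG ne_GF].
  have /subsetPn[b Gb Fb] : ~~ (G \subset F).
    by apply: contra ne_GF => sGF; rewrite eqEcard sGF cG leqnn.
  have := vars_xprod Gb Fb; apply: ideal_genS => u vu.
  by apply: ideal_gen_sub; left.
- rewrite /xprod; elim/big_ind: _ => [||b Fb]; first exact: nonzerodivisor1.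
    by move=> *; apply: nonzerodivisorM.
  by apply: D => //; rewrite -eq_iF.
Qed.

(** Induction on #|U|, removing a set F of minimal cardinality: no remaining set
    is contained in F, so the remaining generators involve variables
    outside F, and up-closure puts x_b x_F among them for b outside F. *)
Lemma esyms_upset_regular U d : (d <= n)%N ->
  (forall F, F \in U -> (d < #|F|)%N) ->
  (forall F G, F \in U -> F \subset G -> G \in U) ->
  forall i, (i < d)%N ->
  nonzerodivisor (ideal_gen (xprods U `|` esyms i)) (mesym n K i.+1).
Proof.
move=> le_dn; have [r] := ubnP #|U|; elim: r U => // r IHr U lt_Ur cardU upU i lt_id.
have [U0|[F0 UF0]] := set_0Vmem U.
  have [|reg _] := @esyms_vars_regular [set: 'I_n] i.
    by rewrite cardsT card_ord (leq_trans lt_id).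
  suff -> : xprods U = vars (~: [set: 'I_n]) by [].
  by apply/seteqP; split=> u [b] /=; rewrite ?U0 !inE.
case: (arg_minnP (fun F : {set 'I_n} => #|F|) UF0) => F UF_ minF.
have UF : F \in U by [].
have nsub G : G \in U :\ F -> exists2 b, b \in G & b \notin F.
  rewrite !inE => /andP[ne_GF UG]; apply/subsetPn; apply: contra ne_GF => sGF.
  by rewrite eqEcard sGF minF.
have -> : xprods U `|` esyms i =
    xprods (U :\ F) `|` esyms i `|` [set xprod F].
  apply/seteqP; split=> u.
    case=> [[G /= UG <-]|eu]; last by left; right.
    have [->|ne_GF] := eqVneq G F; first by right.
    by left; left; exists G => //=; rewrite !inE ne_GF.
  case=> [[[G /= UG <-]|eu]|->]; [|by right|by left; exists F].
  by left; exists G => //=; move: UG; rewrite !inE => /andP[].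
apply: (@nonzerodivisor_step _ _ (vars (~: F))).
- by move=> _ [G /nsub[b Gb Fb] <-]; apply: vars_xprod Gb Fb.
- move=> _ [b /= Fb <-]; rewrite inE in Fb.
  apply: ideal_gen_sub; exists (b |: F); last by rewrite /xprod big_setU1 //= mulrC.
  have UbF : (b |: F)%SET \in U by apply: upU UF _; apply: finset.subsetUr.
  rewrite /= !inE UbF andbT; apply: contra Fb => /eqP <-; exact: setU11.
- rewrite -setU_esymsS /xprod; elim/big_ind: _ => [||b Fb].
  + exact: nonzerodivisor1.
  + by move=> *; apply: nonzerodivisorM.
  + have [|_ D] := @esyms_vars_regular F i.+1; last exact: D.
    exact: leq_ltn_trans lt_id (cardU F UF).
- apply: IHr => // [|G|G H].
  + by move: lt_Ur; rewrite (cardsD1 F) UF.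
  + by rewrite inE => /andP[_ /cardU].
  + rewrite !inE => /andP[ne_GF UG] sGH; rewrite (upU G) // andbT.
    apply: contra ne_GF => /eqP eq_HF; rewrite eq_HF in sGH.
    by rewrite eqEcard sGH minF.
Qed.

Lemma graded_max_idealP (f : {mpoly K[n]}) : graded_max_ideal f <-> f@_0 = 0.
Proof.
have -> : @graded_max_ideal K n = monomial_ideal [set U_(i)%MM | i in [set: 'I_n]].
  rewrite /graded_max_ideal /monomial_ideal; congr ideal_gen.
  apply/seteqP; split=> u; first by case=> i _ <-; exists U_(i)%MM => //; exists i.
  by case=> m [i _ <-] <-; exists i.
split=> [/monomial_idealP suppf|f0].
  apply: memN_msupp_eq0; apply/negP => /suppf[_ [i _ <-]].
  by move=> /mnm_lepP/(_ i); rewrite mnm1E eqxx mnm0E.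
apply/monomial_idealP => m fm.
have : m != 0%MM by apply: contraTneq fm => ->; rewrite mcoeff_msupp f0 eqxx.
rewrite -mdeg_eq0 mdegE sum_nat_eq0 => /forallPn[i]; rewrite /= -lt0n => mi.
exists U_(i)%MM; first by exists i.
by apply/mnm_lepP => j; rewrite mnm1E; have [<-|] := eqVneq i j.
Qed.

Lemma squarefree_mesym1 (m : 'X_{1..n}) : squarefree m ->
  m = mesym1 [set i | m i != 0%N]%SET.
Proof.
move=> sq; apply/mnmP => i; rewrite mnmE inE.
by have := sq i; case: (m i) => [|[]].
Qed.

Lemma xprodE F : xprod F = 'X_[mesym1 F].
Proof.
rewrite /xprod mprodXE; congr 'X_[_]; apply/mnmP => i; rewrite mnm_sumE mnmE.
rewrite big_mkcond (bigD1 i) //= mnm1E eqxx big1 ?addn0 => [|j ne_ji].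
  by case: (i \in F).
by case: (j \in F) => //; rewrite mnm1E (negPf ne_ji).
Qed.

(** The sequence e_1, ..., e_d realizes the bound.  The ideal is generated by the
    x_F that it contains, and these F form an up-closed family whose members
    have more than d elements. *)
Lemma depth_squarefree_monomial_ideal (A : set 'X_{1..n}) d :
  A !=set0 -> (forall a, A a -> squarefree a /\ (d < mdeg a)%N) ->
  (d <= depth (@monomial_ideal K n A))%N.
Proof.
move=> [a0 Aa0] AP; set J := monomial_ideal A.
pose U := [set F : {set 'I_n} | `[< exists2 a, A a & (a <= mesym1 F)%MM >]]%SET.
have degU F : F \in U -> (d < #|F|)%N.
  rewrite inE => /asboolP[a /AP[_ lt_d] /mnm_lepP le_a].
  by rewrite -mdeg_mesym1 (leq_trans lt_d) // !mdegE leq_sum.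
have upU F G : F \in U -> F \subset G -> G \in U.
  rewrite inE => /asboolP[a Aa le_a] /fintype.subsetP sFG.
  rewrite inE; apply/asboolP; exists a => //.
  apply: lepm_trans le_a _; apply/mnm_lepP => i; rewrite !mnmE.
  by case: (boolP (i \in F)) => // /sFG ->.
have genU : ideal_gen (xprods U) = J.
  apply/seteqP; split; apply: ideal_genS => u.
    by case=> F /=; rewrite inE => /asboolP FA <-; rewrite xprodE; apply/monomial_idealX.
  case=> a Aa <-; apply: ideal_gen_sub; exists [set i | a i != 0%N]%SET.
    rewrite /= inE; apply/asboolP; exists a => //.
    by rewrite -squarefree_mesym1 ?lepm_refl //; case: (AP a Aa).
  by rewrite xprodE -squarefree_mesym1 //; case: (AP a Aa).
have le_dn : (d <= n)%N.
  have [sq0 lt_d0] := AP a0 Aa0; apply: leq_trans (ltnW lt_d0) _.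
  by rewrite (squarefree_mesym1 sq0) mdeg_mesym1 -[n in (_ <= n)%N]card_ord max_card.
have idJ : is_ideal J by apply: ideal_gen_ideal.
have max_esym i f : esyms i f -> graded_max_ideal f.
  case/mapP => j; rewrite mem_iota => /andP[lt0j _] ->.
  apply/graded_max_idealP; rewrite mcoeff_mesym /mechar mdeg0.
  by rewrite eq_sym (gtn_eqF lt0j).
have size_s : size [seq mesym n K j | j <- iota 1 d] = d.
  by rewrite size_map size_iota.
rewrite -[d in (d <= _)%N]size_s; apply: depth_ge => //.
  by move=> f fs; apply: (max_esym d).
split.
  rewrite size_s => i lt_id; rewrite -map_take take_iota (minn_idPl (ltnW lt_id)).
  rewrite (nth_map 0%N) ?size_iota // nth_iota // add1n -genU ideal_gen_genU.
  exact: (esyms_upset_regular le_dn degU upU lt_id).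
move=> J1; have : graded_max_ideal (1 : {mpoly K[n]}).
  move: J1; apply: ideal_genS => u [Ju|/max_esym //].
  move: Ju; apply: ideal_genS => _ [a /AP[_ lt_d] <-]; apply/graded_max_idealP.
  rewrite mcoeffX; case: eqP => // a0'; move: lt_d.
  by rewrite a0' mdeg0.
by move/graded_max_idealP/eqP; rewrite mcoeff1 eqxx oner_eq0.
Qed.

End ElementarySymmetric.

(** * Squarefree powers and normalized depth *)

Theorem proposition1p1 (K : fieldType) (n : nat) (I : set {mpoly K[n]})
    (HI : squarefree_monomial_ideal I) :
  (forall k : nat, (1 <= k)%N ->
     (squarefree_power I k = [set 0] <-> (nu I < k)%N)) /\
  (forall k : nat, (1 <= k <= nu I)%N -> 0 <= normalized_depth I k).
Proof.
split=> [k _|k _]; first exact: squarefree_power_eq0.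
rewrite /normalized_depth; suff : ((min_degree I k).-1 <= depth (squarefree_power I k))%N.
  by case: (min_degree I k) => [|d] /=; lia.
rewrite /min_degree; set D := (X in nat_min X).
case e: (nat_min D) => [|d] //=; rewrite /squarefree_power; set A := (X in monomial_ideal X).
have DA a : A a -> (d < mdeg a)%N.
  move=> Aa; rewrite -e.
  have [|u Gu /mnm_lepP le_u] := @mingens_dvd K n A a.
    by apply/monomial_idealX; exists a; rewrite ?lepm_refl.
  apply: (@leq_trans (mdeg u)); first by apply: nat_min_le; exists u.
  by rewrite !mdegE leq_sum.
apply: depth_squarefree_monomial_ideal => [|a Aa]; last first.
  by split; [case: Aa => ? [] | apply: DA].
(* Without generators the minimal degree would be the default value 0. *)
apply/set0P/negP => /eqP A0.
suff D0 : D = set0 by rewrite D0 in e; move: e; rewrite /nat_min /infimum eqxx.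
apply/seteqP; split=> // x [u Gu _].
by have := mingens_sub_gens Gu; rewrite -/A A0.
Qed.
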